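(* For any non-negative integers $m,n$, \[\zeta^\star(\{2\}^{m+1},1,\{2\}^{n}) =2\sum_{r=1}^{m+n+1}\Biggl(\binom{2r}{2m+2}-(1-4^{-r})\binom{2r}{2n-1}\Biggr)\zeta(2r+1)\,\zeta^\star(\{2\}^{m+n+1-r}).\]
   Context: $\zeta(s)$ is the Riemann zeta function. For positive integers $k_1,\ldots,k_r$ with $k_1\geq 2$, $\zeta^\star(k_1,\ldots,k_r)=\sum_{m_1\geq\cdots\geq m_r\geq 1} m_1^{-k_1}\cdots m_r^{-k_r}$; $\zeta^\star$ of the empty index is $1$; $\{2\}^j$ denotes $j$ copies of $2$. Binomial coefficients $\binom{a}{b}$ are $0$ when $b<0$ or $b>a$. *)

(* Defs.v *)
From Stdlib Require Import Reals List ZArith.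
From Coquelicot Require Import Coquelicot.
Open Scope R_scope.

Fixpoint binom (a b : nat) : nat :=
  match a, b with
  | _, O => 1%nat
  | O, S _ => 0%nat
  | S a', S b' => (binom a' b' + binom a' (S b'))%nat
  end.

Definition binomZ (a : nat) (b : Z) : R :=
  if (b <? 0)%Z then 0 else INR (binom a (Z.to_nat b)).

Fixpoint zeta_star_trunc (l : list nat) (M : nat) : R :=
  match l with
  | nil => 1
  | k :: l' => sum_n_m (fun m => / (INR m) ^ k * zeta_star_trunc l' m) 1 M
  end.

(* zeta^*(k1,...,kr) := lim_{N -> oo} of the truncated sums (a series of
   nonnegative terms, convergent when k1 >= 2); zeta^*() = 1. *)
Definition zeta_star (l : list nat) : R :=
  real (Lim_seq (fun N => zeta_star_trunc l N)).

Definition zeta (s : nat) : R := zeta_star (s :: nil).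

(* Main.v *)
(* Put c(M,k) = M!^2 / ((M-k)! (M+k)!).  Since c(M,k) - c(M-1,k) = (k/M)^2 c(M,k)
   and M (c(M,k) - c(M,k+1)) = k c(M,k) + (k+1) c(M,k+1), the truncated star sums
   have expansions sum_k c(M,k) d_k in which prepending a 2 divides d_k by k^2 and
   prepending a 1 replaces d_k by (D_k + D_{k-1}) / k, with D the partial sums of d.
   Letting M tend to infinity (Tannery), with a = 2m+3 and b = 2n,
     zeta^*({2}^{m+1},1,{2}^n)
       = 2 sum_k k^{-a} (2 sum_{j<k} (-1)^{j-1} j^{-b} + (-1)^{k-1} k^{-b}),
     zeta^*({2}^i) = 2 sum_k (-1)^{k-1} k^{-2i}   (i >= 1).
   For n >= 1 the double sum is rewritten along the differences N = k - j as -2 sum_N S_N(a,b),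
   where S_N(a,b) is the sum of (-1)^j / ((j+N)^a j^b) over the integers j other than 0 and -N.
   From N = (j+N) - j one gets N S_N(a+1,b+1) = S_N(a,b+1) - S_N(a+1,b), so S_N(a,b)
   is a combination, with binomial coefficients, of N^{-c} times the two-sided sums of
   (-1)^j j^{-(a+b-c)}; these vanish when a+b-c is odd and are values -zeta^*({2}^i)
   when it is even. *)

Require Import Defs.
From Stdlib Require Import Reals List ZArith Lra Lia.
From Coquelicot Require Import Coquelicot.
Open Scope R_scope.

(** * Finite sums over [1..n] *)

(** Convertible with the sums in the final statement and in [zeta_star_trunc], so that [change] and
    [exact] can pass between the two. *)
Definition psum (f : nat -> R) (n : nat) : R := sum_n_m f 1 n.

Lemma psum_0 f : psum f 0 = 0.
Proof. unfold psum. rewrite sum_n_m_zero; [reflexivity | lia]. Qed.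

Lemma psum_S f n : psum f (S n) = psum f n + f (S n).
Proof. unfold psum. rewrite sum_n_Sm; [reflexivity | lia]. Qed.

Lemma psum_ext f g n :
  (forall k, (1 <= k <= n)%nat -> f k = g k) -> psum f n = psum g n.
Proof. intros H. apply sum_n_m_ext_loc. exact H. Qed.

Lemma psum_shift f n : psum f (S n) = f 1%nat + psum (fun k => f (S k)) n.
Proof.
induction n as [|n IH].
- rewrite psum_S, !psum_0. ring.
- rewrite psum_S, IH, psum_S. ring.
Qed.

Lemma psum_plus f g n : psum (fun k => f k + g k) n = psum f n + psum g n.
Proof. induction n as [|n IH]; [rewrite !psum_0; ring|rewrite !psum_S, IH; ring]. Qed.

Lemma psum_scal c f n : psum (fun k => c * f k) n = c * psum f n.
Proof. induction n as [|n IH]; [rewrite !psum_0; ring|rewrite !psum_S, IH; ring]. Qed.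

Lemma psum_swap (f : nat -> nat -> R) m n :
  psum (fun i => psum (f i) n) m = psum (fun j => psum (fun i => f i j) m) n.
Proof.
induction m as [|m IH].
- rewrite psum_0. symmetry. induction n as [|n IH]; rewrite ?psum_0, ?psum_S; [ring|].
  rewrite IH, psum_0. ring.
- rewrite psum_S, IH, <- psum_plus. apply psum_ext. intros k _. now rewrite psum_S.
Qed.

Lemma psum_le f g n :
  (forall k, (1 <= k)%nat -> f k <= g k) -> psum f n <= psum g n.
Proof.
intros H; induction n as [|n IH]; rewrite ?psum_0, ?psum_S; [lra|].
specialize (H (S n) ltac:(lia)). lra.
Qed.

Lemma psum_eq0 f n : (forall k, (1 <= k <= n)%nat -> f k = 0) -> psum f n = 0.
Proof.
intros H. rewrite (psum_ext f (fun k => 0 * 0)).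
- rewrite psum_scal. ring.
- intros k Hk. rewrite H; [ring|easy].
Qed.

Lemma psum_single f i n :
  (1 <= i <= n)%nat -> (forall k, (1 <= k <= n)%nat -> k <> i -> f k = 0) ->
  psum f n = f i.
Proof.
intros Hi H; induction n as [|n IH]; [lia|].
rewrite psum_S. destruct (Nat.eq_dec i (S n)) as [->|E].
- rewrite psum_eq0; [ring|]. intros k Hk. apply H; lia.
- rewrite IH, (H (S n)); [ring|lia|lia|lia|]. intros k Hk E'. apply H; lia.
Qed.

Lemma Rabs_psum_tail f B K L :
  (forall k, (1 <= k)%nat -> Rabs (f k) <= B k) -> (K <= L)%nat ->
  Rabs (psum f L - psum f K) <= psum B L - psum B K.
Proof.
intros H HL; induction HL as [|L HL IH].
- rewrite !Rminus_diag, Rabs_R0. lra.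
- rewrite !psum_S. specialize (H (S L) ltac:(lia)).
  replace (psum f L + f (S L) - psum f K) with ((psum f L - psum f K) + f (S L)) by ring.
  pose proof (Rabs_triang (psum f L - psum f K) (f (S L))). lra.
Qed.

Lemma Rabs_psum f B L :
  (forall k, (1 <= k)%nat -> Rabs (f k) <= B k) -> Rabs (psum f L) <= psum B L.
Proof.
intros H. pose proof (Rabs_psum_tail f B 0 L H ltac:(lia)) as E.
rewrite !psum_0, !Rminus_0_r in E. exact E.
Qed.

(** * Dominated series and two forms of Tannery's theorem *)

Lemma psum_dominated_cv f B (s : R) :
  (forall k, (1 <= k)%nat -> Rabs (f k) <= B k) -> is_lim_seq (psum B) s ->
  exists l : R, is_lim_seq (psum f) l.
Proof.
intros H HB.
assert (C : ex_finite_lim_seq (psum f)); [|exact C].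
apply ex_lim_seq_cauchy_corr. intros eps.
assert (CB : ex_lim_seq_cauchy (psum B)).
{ apply ex_lim_seq_cauchy_corr. now exists s. }
destruct (CB eps) as [N HN]. exists N. intros n m Hn Hm.
specialize (HN n m Hn Hm).
destruct (Nat.le_ge_cases n m) as [E|E].
- rewrite Rabs_minus_sym. eapply Rle_lt_trans; [apply (Rabs_psum_tail f B); assumption|].
  rewrite Rabs_minus_sym in HN. eapply Rle_lt_trans; [apply Rle_abs|exact HN].
- eapply Rle_lt_trans; [apply (Rabs_psum_tail f B); assumption|].
  eapply Rle_lt_trans; [apply Rle_abs|exact HN].
Qed.

Lemma is_lim_seq_eq (u : nat -> R) (a b : R) : is_lim_seq u a -> is_lim_seq u b -> a = b.
Proof.
intros Ha Hb. apply is_lim_seq_unique in Ha, Hb. rewrite Ha in Hb. now injection Hb.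
Qed.

Lemma is_lim_seq_psum (f : nat -> nat -> R) (g : nat -> R) n :
  (forall k, (1 <= k <= n)%nat -> is_lim_seq (fun M => f M k) (g k)) ->
  is_lim_seq (fun M => psum (f M) n) (psum g n).
Proof.
intros H; induction n as [|n IH].
- apply is_lim_seq_ext with (fun _ => 0); [intros; now rewrite psum_0|].
  rewrite psum_0. apply is_lim_seq_const.
- apply is_lim_seq_ext with (fun M => psum (f M) n + f M (S n)).
  + intros; now rewrite psum_S.
  + rewrite psum_S. apply is_lim_seq_plus'; [apply IH; intros; apply H; lia|apply H; lia].
Qed.

(** A three-epsilon argument, the common core of both Tannery lemmas: only the first [K] terms need
    to converge, once the error of cutting at [K] is at most [e K] for all [M >= K]. *)
Lemma is_lim_seq_uniform_tail (phi : nat -> R) (f : nat -> nat -> R) (g e : nat -> R) (l : R) :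
  (forall K M, (K <= M)%nat -> Rabs (phi M - psum (f M) K) <= e K) ->
  is_lim_seq e 0 ->
  (forall k, (1 <= k)%nat -> is_lim_seq (fun M => f M k) (g k)) ->
  is_lim_seq (psum g) l -> is_lim_seq phi l.
Proof.
intros H He Hf Hg. apply is_lim_seq_spec. intros eps.
apply is_lim_seq_spec in He. apply is_lim_seq_spec in Hg.
assert (E3 : 0 < eps / 3) by (pose proof (cond_pos eps); lra).
destruct (He (mkposreal _ E3)) as [K1 HK1].
destruct (Hg (mkposreal _ E3)) as [K2 HK2].
set (K := (K1 + K2)%nat).
specialize (HK1 K ltac:(unfold K; lia)). specialize (HK2 K ltac:(unfold K; lia)).
assert (HL := is_lim_seq_psum f g K (fun k Hk => Hf k (proj1 Hk))).
apply is_lim_seq_spec in HL. destruct (HL (mkposreal _ E3)) as [M0 HM].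
exists (M0 + K)%nat. intros M HM'.
specialize (HM M ltac:(lia)). specialize (H K M ltac:(lia)).
simpl in *. rewrite Rminus_0_r in HK1. pose proof (Rle_abs (e K)).
replace (phi M - l) with
  ((phi M - psum (f M) K) + (psum (f M) K - psum g K) + (psum g K - l)) by ring.
pose proof (Rabs_triang ((phi M - psum (f M) K) + (psum (f M) K - psum g K)) (psum g K - l)).
pose proof (Rabs_triang (phi M - psum (f M) K) (psum (f M) K - psum g K)).
lra.
Qed.

Lemma is_lim_seq_tail_0 (B : nat -> R) (s : R) :
  is_lim_seq (psum B) s -> is_lim_seq (fun K => s - psum B K) 0.
Proof.
intros H. replace (Finite 0) with (Finite (s - s)) by (f_equal; ring).
apply is_lim_seq_minus'; [apply is_lim_seq_const|exact H].
Qed.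

Lemma psum_le_lim (B : nat -> R) (s : R) K :
  (forall k, (1 <= k)%nat -> 0 <= B k) -> is_lim_seq (psum B) s -> psum B K <= s.
Proof.
intros H Hs. apply (is_lim_seq_incr_compare (psum B)); [exact Hs|].
intros n. rewrite psum_S. specialize (H (S n) ltac:(lia)). lra.
Qed.

(** For truncated star sums, where the terms and their number both grow with [M]. *)
Lemma tannery_diag (f : nat -> nat -> R) (g B : nat -> R) (s l : R) :
  (forall M k, (1 <= k)%nat -> Rabs (f M k) <= B k) -> is_lim_seq (psum B) s ->
  (forall k, (1 <= k)%nat -> is_lim_seq (fun M => f M k) (g k)) ->
  is_lim_seq (psum g) l -> is_lim_seq (fun M => psum (f M) M) l.
Proof.
intros HB Hs Hf Hg.
apply (is_lim_seq_uniform_tail _ f g (fun K => s - psum B K)); auto.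
- intros K M HKM. eapply Rle_trans; [apply (Rabs_psum_tail _ B); auto|].
  assert (psum B M <= s); [|lra].
  apply psum_le_lim; auto. intros k Hk.
  eapply Rle_trans; [apply Rabs_pos|apply (HB 0%nat k Hk)].
- now apply is_lim_seq_tail_0.
Qed.

(** For full series [phi M], as needed to exchange the sums over [N] and [j]. *)
Lemma tannery_series (f : nat -> nat -> R) (phi g B : nat -> R) (s l : R) :
  (forall M k, (1 <= k)%nat -> Rabs (f M k) <= B k) -> is_lim_seq (psum B) s ->
  (forall M, is_lim_seq (psum (f M)) (phi M)) ->
  (forall k, (1 <= k)%nat -> is_lim_seq (fun M => f M k) (g k)) ->
  is_lim_seq (psum g) l -> is_lim_seq phi l.
Proof.
intros HB Hs Hphi Hf Hg.
apply (is_lim_seq_uniform_tail _ f g (fun K => s - psum B K)); auto.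
- intros K M _.
  (* The tail bound holds for every partial sum [L >= K] and passes to the limit in [L]. *)
  assert (H1 : is_lim_seq (fun L => Rabs (psum (f M) L - psum (f M) K))
                          (Rabs (phi M - psum (f M) K))).
  { apply (is_lim_seq_abs _ (phi M - psum (f M) K)).
    apply is_lim_seq_minus'; [apply Hphi|apply is_lim_seq_const]. }
  refine (is_lim_seq_le_loc _ (fun _ => s - psum B K) _ _ _ H1 (is_lim_seq_const _)).
  exists K. intros L HL. eapply Rle_trans; [apply (Rabs_psum_tail _ B); auto|].
  assert (psum B L <= s); [|lra].
  apply psum_le_lim; auto. intros k Hk.
  eapply Rle_trans; [apply Rabs_pos|apply (HB 0%nat k Hk)].
- now apply is_lim_seq_tail_0.
Qed.

(** * Inverse powers and their sums *)

(* [ipow 0 a = 0] for [a > 0], as [/ 0 = 0]. *)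
Definition ipow (k a : nat) : R := (/ INR k) ^ a.

Lemma INR_ge1_pos k : (1 <= k)%nat -> 0 < INR k.
Proof. intros H. apply lt_0_INR. lia. Qed.

Lemma inv_INR_bounds k : (1 <= k)%nat -> 0 < / INR k <= 1.
Proof.
intros H. split; [apply Rinv_0_lt_compat, INR_ge1_pos, H|].
rewrite <- Rinv_1. apply Rinv_le_contravar; [lra|]. apply (le_INR 1). exact H.
Qed.

Lemma ipow_bounds k a : (1 <= k)%nat -> 0 <= ipow k a <= 1.
Proof.
intros H. pose proof (inv_INR_bounds k H). unfold ipow. split.
- apply pow_le; lra.
- rewrite <- (pow1 a). apply pow_incr; lra.
Qed.

Lemma ipow_le_2 k a : (1 <= k)%nat -> (2 <= a)%nat -> ipow k a <= ipow k 2.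
Proof.
intros H Ha. replace a with (2 + (a - 2))%nat by lia. unfold ipow. rewrite pow_add.
pose proof (ipow_bounds k (a - 2) H). pose proof (ipow_bounds k 2 H).
unfold ipow in *. nra.
Qed.

Lemma psum_ipow_2_le M : psum (fun k => ipow k 2) M <= 2.
Proof.
(* The sharper bound [2 - 1/M] is what induction can carry, since [1/(x+1)^2 <= 1/x - 1/(x+1)]. *)
assert (H : psum (fun k => ipow k 2) (S M) <= 2 - / INR (S M)).
{ induction M as [|M IH].
  - rewrite psum_S, psum_0. unfold ipow. simpl. rewrite Rinv_1. lra.
  - rewrite psum_S. unfold ipow at 2. rewrite (S_INR (S M)).
    pose proof (INR_ge1_pos (S M) ltac:(lia)) as Hp. set (x := INR (S M)) in *.
    assert (E : / x - / (x + 1) - (/ (x + 1)) ^ 2 = / x * (/ (x + 1)) ^ 2) by (field; lra).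
    assert (0 <= / x * (/ (x + 1)) ^ 2).
    { apply Rmult_le_pos; [apply Rlt_le, Rinv_0_lt_compat; lra|apply pow2_ge_0]. }
    lra. }
rewrite psum_S in H. pose proof (ipow_bounds (S M) 2 ltac:(lia)).
pose proof (inv_INR_bounds (S M) ltac:(lia)). lra.
Qed.

Lemma psum_ipow_le a M : (2 <= a)%nat -> 0 <= psum (fun k => ipow k a) M <= 2.
Proof.
intros Ha. split.
- replace 0 with (0 * psum (fun _ => 0) M) by ring. rewrite <- psum_scal.
  apply psum_le. intros k Hk. pose proof (ipow_bounds k a Hk). lra.
- eapply Rle_trans; [|apply (psum_ipow_2_le M)].
  apply psum_le. intros k Hk. now apply ipow_le_2.
Qed.

Lemma psum_ipow_cv a : (2 <= a)%nat -> exists s : R, is_lim_seq (psum (fun k => ipow k a)) s.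
Proof.
intros Ha.
assert (C : ex_finite_lim_seq (psum (fun k => ipow k a))); [|exact C].
apply (ex_finite_lim_seq_incr _ 2).
- intros n. rewrite psum_S. pose proof (ipow_bounds (S n) a ltac:(lia)). lra.
- intros n. apply psum_ipow_le, Ha.
Qed.

(** * Signs and the weights [cc] *)

Lemma pow_m1_double k : (-1) ^ (2 * k) = 1.
Proof. rewrite pow_mult. replace ((-1) ^ 2) with 1 by ring. apply pow1. Qed.

(* [M!^2 / ((M-k)! (M+k)!)], equal to [0] for [k > M]. *)
Fixpoint cc (M k : nat) : R :=
  match k with
  | O => 1
  | S k' => cc M k' * ((INR M - INR k') / (INR M + INR k' + 1))
  end.

(** Division-free and valid for all [k]; this relation makes sums weighted by [cc] telescope in
    [k]. *)
Lemma cc_step M k : (INR M + INR k + 1) * cc M (S k) = (INR M - INR k) * cc M k.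
Proof. simpl. field. pose proof (pos_INR M). pose proof (pos_INR k). lra. Qed.

Lemma cc_gt M k : (M < k)%nat -> cc M k = 0.
Proof.
intros H; induction H as [|k H IH]; simpl; [|rewrite IH; ring].
rewrite Rminus_diag. unfold Rdiv. ring.
Qed.

Lemma cc_bounds M k : 0 <= cc M k <= 1.
Proof.
destruct (Nat.lt_ge_cases M k) as [H|H]; [rewrite cc_gt by easy; lra|].
induction k as [|k IH]; simpl; [lra|].
specialize (IH ltac:(lia)).
pose proof (pos_INR k). pose proof (le_INR _ _ H) as H'. rewrite S_INR in H'.
set (q := (INR M - INR k) / (INR M + INR k + 1)).
assert (0 <= q <= 1).
{ unfold q. split.
  - apply Rdiv_le_0_compat; lra.
  - apply Rle_div_l; lra. }
nra.
Qed.

(** The relation between consecutive [M] with denominators cleared, so that it also covers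
    [k = S M], where both sides vanish. *)
Lemma cc_pred M k :
  (INR (S M) ^ 2 - INR k ^ 2) * cc (S M) k = INR (S M) ^ 2 * cc M k.
Proof.
induction k as [|k IH]; [simpl; ring|].
pose proof (pos_INR k). pose proof (pos_INR M).
cbn [cc]. rewrite !S_INR in *.
set (x := INR M) in *. set (y := INR k) in *.
replace ((x + 1) ^ 2 * (cc M k * ((x - y) / (x + y + 1))))
  with ((x + 1) ^ 2 * cc M k * ((x - y) / (x + y + 1))) by ring.
rewrite <- IH. field. lra.
Qed.

(** Each factor of [cc M k] has the form [1 - (2i+1)/(M+i+1)]. *)
Lemma cc_cv k : is_lim_seq (fun M => cc M k) 1.
Proof.
induction k as [|k IH]; simpl; [apply is_lim_seq_const|].
replace (Finite 1) with (Finite (1 * (1 - (2 * INR k + 1) * 0))) by (f_equal; ring).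
apply is_lim_seq_mult'; [exact IH|].
apply is_lim_seq_ext with (fun M => 1 - (2 * INR k + 1) * / (INR M + (INR k + 1))).
{ intros M. field. pose proof (pos_INR M). pose proof (pos_INR k). lra. }
apply is_lim_seq_minus'; [apply is_lim_seq_const|].
apply is_lim_seq_mult'; [apply is_lim_seq_const|].
apply (is_lim_seq_inv _ p_infty); [|easy].
eapply is_lim_seq_plus; [apply is_lim_seq_INR|apply is_lim_seq_const|reflexivity].
Qed.

(** * Expansions of truncated star sums in the weights [cc] *)

Lemma zst_cons_S k l M :
  zeta_star_trunc (k :: l) (S M) =
  zeta_star_trunc (k :: l) M + ipow (S M) k * zeta_star_trunc l (S M).
Proof.
simpl zeta_star_trunc. unfold ipow. rewrite sum_n_Sm by lia. rewrite pow_inv. reflexivity.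
Qed.

Lemma zst_cons_0 k l : zeta_star_trunc (k :: l) 0 = 0.
Proof. exact (psum_0 (fun m => / INR m ^ k * zeta_star_trunc l m)). Qed.

Lemma psum_cc_diff (d : nat -> R) M :
  INR (S M) ^ 2 * (psum (fun k => cc (S M) k * d k) (S M) - psum (fun k => cc M k * d k) M) =
  psum (fun k => cc (S M) k * (INR k ^ 2 * d k)) (S M).
Proof.
(* The added term [k = S M] has weight 0. *)
replace (psum (fun k => cc M k * d k) M) with (psum (fun k => cc M k * d k) (S M))
  by (rewrite psum_S, cc_gt by lia; ring).
transitivity (INR (S M) ^ 2 *
  psum (fun k => cc (S M) k * d k + (-1) * (cc M k * d k)) (S M)).
{ rewrite psum_plus, psum_scal. ring. }
rewrite <- psum_scal. apply psum_ext. intros k _.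
transitivity ((INR (S M) ^ 2 * cc (S M) k - INR (S M) ^ 2 * cc M k) * d k); [ring|].
rewrite <- cc_pred. ring.
Qed.

(** At [M = 0] the left side is 1 and the right side an empty sum. The factor [ipow k 0] is 1, kept
    for the shape of [alt2]. *)
Lemma zst_nil_expansion M :
  (1 <= M)%nat ->
  zeta_star_trunc nil M = psum (fun k => cc M k * (-2 * (-1) ^ k * ipow k 0)) M.
Proof.
intros HM. simpl zeta_star_trunc.
(* Telescoping by [cc_step]; the remainder [(M-K) c(M,K)] vanishes at [K = M]. *)
assert (H : forall K, INR M * psum (fun k => cc M k * (-2 * (-1) ^ k * ipow k 0)) K =
                 INR M - (-1) ^ K * ((INR M - INR K) * cc M K)).
{ induction K as [|K IH]; [rewrite psum_0; simpl; ring|].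
  rewrite psum_S, Rmult_plus_distr_l, IH, <- cc_step. unfold ipow. rewrite S_INR.
  simpl pow. ring. }
specialize (H M). pose proof (INR_ge1_pos M HM).
apply (Rmult_eq_reg_l (INR M)); [|lra]. rewrite H. ring.
Qed.

(** Both sides vanish at [M = 0] and have equal increments in [M] by [psum_cc_diff], whose factor
    [k^2] cancels [ipow k 2]. *)
Lemma zst_cons2_expansion l d :
  (forall M, (1 <= M)%nat -> zeta_star_trunc l M = psum (fun k => cc M k * d k) M) ->
  forall M, zeta_star_trunc (2%nat :: l) M = psum (fun k => cc M k * (ipow k 2 * d k)) M.
Proof.
intros H M; induction M as [|M IH]; [now rewrite zst_cons_0, psum_0|].
rewrite zst_cons_S, IH, H by lia.
pose proof (INR_ge1_pos (S M) ltac:(lia)).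
apply (Rmult_eq_reg_l (INR (S M) ^ 2)); [|apply pow_nonzero; lra].
pose proof (psum_cc_diff (fun k => ipow k 2 * d k) M) as E. cbv beta in E.
rewrite (psum_ext (fun k => cc (S M) k * (INR k ^ 2 * (ipow k 2 * d k)))
           (fun k => cc (S M) k * d k)) in E.
- assert (I : INR (S M) ^ 2 * ipow (S M) 2 = 1) by (unfold ipow; field; lra).
  rewrite Rmult_plus_distr_l, <- Rmult_assoc, I, <- E. ring.
- intros k Hk. unfold ipow. field. pose proof (INR_ge1_pos k ltac:(lia)). lra.
Qed.

Lemma zst_cons1_expansion l u :
  (forall M, (1 <= M)%nat -> zeta_star_trunc l M = psum (fun k => cc M k * u k) M) ->
  forall M, zeta_star_trunc (1%nat :: l) M =
    psum (fun k => cc M k * (/ INR k * (psum u k + psum u (pred k)))) M.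
Proof.
intros H M; induction M as [|M IH]; [now rewrite zst_cons_0, psum_0|].
rewrite zst_cons_S, IH, H by lia.
pose proof (INR_ge1_pos (S M) ltac:(lia)) as HM.
set (d := fun k => / INR k * (psum u k + psum u (pred k))).
pose proof (psum_cc_diff d M) as E.
(* Summation by parts in [k]: the boundary term [(N-K) c(N,K) U_K], with [U] the partial sums of
   [u], is carried along by [cc_step] and vanishes at [K = N]. *)
assert (A : forall N K, psum (fun k => cc N k * (INR k ^ 2 * d k)) K =
    INR N * psum (fun k => cc N k * u k) K - (INR N - INR K) * cc N K * psum u K).
{ intros N K; induction K as [|K IHK]; [rewrite !psum_0; ring|].
  rewrite 2!psum_S, IHK, <- cc_step. unfold d.
  simpl pred. rewrite !(psum_S u K), S_INR. field.
  pose proof (pos_INR K). lra. }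
rewrite A in E.
apply (Rmult_eq_reg_l (INR (S M) ^ 2)); [|apply pow_nonzero; lra].
change (fun k => cc M k * (/ INR k * (psum u k + psum u (pred k)))) with (fun k => cc M k * d k).
change (fun k => cc (S M) k * (/ INR k * (psum u k + psum u (pred k))))
  with (fun k => cc (S M) k * d k).
assert (I : INR (S M) ^ 2 * ipow (S M) 1 = INR (S M)) by (unfold ipow; field; lra).
rewrite Rminus_diag, !Rmult_0_l, Rminus_0_r in E.
rewrite Rmult_plus_distr_l, <- Rmult_assoc, I, <- E. ring.
Qed.

Lemma ipow_add k a b : ipow k (a + b) = ipow k a * ipow k b.
Proof. apply pow_add. Qed.

Lemma zst_repeat2_app_expansion l d i :
  (forall M, (1 <= M)%nat -> zeta_star_trunc l M = psum (fun k => cc M k * d k) M) ->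
  forall M, (1 <= M)%nat ->
  zeta_star_trunc (repeat 2%nat i ++ l) M =
  psum (fun k => cc M k * (ipow k (2 * i) * d k)) M.
Proof.
intros H; induction i as [|i IH]; intros M HM.
- simpl app. rewrite H by easy. apply psum_ext. intros. unfold ipow. simpl. ring.
- simpl app. rewrite (zst_cons2_expansion _ _ IH). apply psum_ext. intros k _.
  replace (2 * S i)%nat with (2 + 2 * i)%nat by lia. rewrite ipow_add. ring.
Qed.

(** The coefficients of [{2}^n] in the weights [cc]. *)
Definition alt2 (n k : nat) : R := -2 * (-1) ^ k * ipow k (2 * n).

Lemma zst_repeat2_expansion n M :
  (1 <= M)%nat ->
  zeta_star_trunc (repeat 2%nat n) M = psum (fun k => cc M k * alt2 n k) M.
Proof.
intros HM. rewrite <- (app_nil_r (repeat _ _)).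
rewrite (zst_repeat2_app_expansion _ _ n zst_nil_expansion) by easy.
apply psum_ext. intros k _. unfold alt2. unfold ipow at 2. simpl (_ ^ 0). ring.
Qed.

(** * Star values as limits of series *)

Lemma zeta_star_unique l (s : R) :
  is_lim_seq (zeta_star_trunc l) s -> zeta_star l = s.
Proof.
intros H. unfold zeta_star. rewrite (is_lim_seq_unique _ s); [easy|].
exact H.
Qed.

(** Since [0 <= cc M k <= 1] and [cc M k] tends to 1, Tannery applies with the bound [B k^-a].
    Domination first yields some limit [t], which is then identified with [zeta_star l]. *)
Lemma cc_expansion_cv l d (B : R) a :
  (forall M, (1 <= M)%nat ->
     zeta_star_trunc l M = psum (fun k => cc M k * (ipow k a * d k)) M) ->
  (2 <= a)%nat -> (forall k, Rabs (d k) <= B) ->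
  is_lim_seq (psum (fun k => ipow k a * d k)) (zeta_star l).
Proof.
intros H Ha HB.
assert (B0 : 0 <= B) by (eapply Rle_trans; [apply Rabs_pos|apply (HB 0%nat)]).
destruct (psum_ipow_cv a Ha) as [s Hs].
set (Bd := fun k => B * ipow k a).
assert (HBd : is_lim_seq (psum Bd) (B * s)).
{ apply is_lim_seq_ext with (fun M => B * psum (fun k => ipow k a) M).
  - intros; unfold Bd; now rewrite psum_scal.
  - apply is_lim_seq_mult'; [apply is_lim_seq_const|exact Hs]. }
assert (Hb : forall k, (1 <= k)%nat -> Rabs (ipow k a * d k) <= Bd k).
{ intros k Hk. unfold Bd. pose proof (ipow_bounds k a Hk). specialize (HB k).
  rewrite Rabs_mult, (Rabs_pos_eq (ipow k a)) by lra. nra. }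
destruct (psum_dominated_cv _ Bd (B * s) Hb HBd) as [t Ht].
replace (zeta_star l) with t; [exact Ht|].
symmetry. apply zeta_star_unique.
apply (is_lim_seq_ext_loc (fun M => psum (fun k => cc M k * (ipow k a * d k)) M)).
{ exists 1%nat. intros M HM. symmetry. now apply H. }
apply (tannery_diag (fun M k => cc M k * (ipow k a * d k)) (fun k => ipow k a * d k) Bd (B * s));
  auto.
- intros M k Hk. rewrite Rabs_mult. pose proof (cc_bounds M k).
  rewrite (Rabs_pos_eq (cc M k)) by lra. specialize (Hb k Hk).
  pose proof (Rabs_pos (ipow k a * d k)). nra.
- intros k Hk.
  replace (Finite (ipow k a * d k)) with (Finite (1 * (ipow k a * d k))) by (f_equal; ring).
  apply is_lim_seq_mult'; [apply cc_cv|apply is_lim_seq_const].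
Qed.

Lemma zeta_star_nil : zeta_star nil = 1.
Proof. apply zeta_star_unique, is_lim_seq_const. Qed.

Lemma Rabs_alt2 n k : (1 <= k)%nat -> Rabs (alt2 n k) = 2 * ipow k (2 * n).
Proof.
intros H. unfold alt2. rewrite !Rabs_mult, pow_1_abs.
rewrite (Rabs_pos_eq (ipow _ _)) by (apply ipow_bounds, H).
rewrite (Rabs_left (-2)) by lra. ring.
Qed.

Lemma psum_alt2_0 k : psum (alt2 0) k = 1 - (-1) ^ k.
Proof.
induction k as [|k IH]; [rewrite psum_0; simpl; ring|].
rewrite psum_S, IH. unfold alt2, ipow. simpl. ring.
Qed.

Lemma Rabs_psum_alt2 n k : Rabs (psum (alt2 n) k) <= 4.
Proof.
(* For [n = 0] the terms do not tend to 0, but the partial sums only take the values 0 and 2. *)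
destruct n as [|n].
- rewrite psum_alt2_0. pose proof (pow_1_abs k).
  destruct (Rabs_def2 ((-1) ^ k) 2); [lra|]. apply Rabs_le. lra.
- eapply Rle_trans; [apply (Rabs_psum _ (fun k => 2 * ipow k (2 * S n)))|].
  + intros j Hj. rewrite Rabs_alt2 by easy. lra.
  + rewrite psum_scal. pose proof (psum_ipow_le (2 * S n) k ltac:(lia)). lra.
Qed.

Lemma zeta_star_repeat2_cv n :
  (1 <= n)%nat -> is_lim_seq (psum (alt2 n)) (zeta_star (repeat 2%nat n)).
Proof.
intros Hn.
apply is_lim_seq_ext with (psum (fun k => ipow k (2 * n) * (-2 * (-1) ^ k))).
{ intros M. apply psum_ext. intros; unfold alt2; ring. }
apply (cc_expansion_cv _ _ 2); [|lia|].
- intros M HM. rewrite zst_repeat2_expansion by easy. apply psum_ext.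
  intros; unfold alt2; ring.
- intros k. rewrite Rabs_mult, pow_1_abs, Rabs_left; lra.
Qed.

Lemma zeta_cv s : (2 <= s)%nat -> is_lim_seq (psum (fun k => ipow k s)) (zeta s).
Proof.
intros Hs. destruct (psum_ipow_cv s Hs) as [t Ht].
replace (zeta s) with t; [exact Ht|]. symmetry. apply zeta_star_unique.
apply is_lim_seq_ext with (2 := Ht). intros M.
change (zeta_star_trunc (s :: nil) M) with (psum (fun k => / INR k ^ s * 1) M).
apply psum_ext. intros k _. unfold ipow. rewrite pow_inv. ring.
Qed.

Lemma zeta_star_212_cv m n :
  is_lim_seq (psum (fun k => ipow k (2 * m + 3) * (psum (alt2 n) k + psum (alt2 n) (pred k))))
    (zeta_star (repeat 2%nat (m + 1) ++ 1%nat :: repeat 2%nat n)).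
Proof.
set (d := fun k => / INR k * (psum (alt2 n) k + psum (alt2 n) (pred k))).
apply is_lim_seq_ext with (psum (fun k => ipow k (2 * (m + 1)) * d k)).
{ intros M. apply psum_ext. intros k _. unfold d.
  replace (2 * m + 3)%nat with (2 * (m + 1) + 1)%nat by lia.
  rewrite ipow_add. unfold ipow at 3. simpl. ring. }
(* The bound 8 is twice the 4 of [Rabs_psum_alt2], as [1/k <= 1]; at [k = 0] the value is 0 by
   [/ 0 = 0]. *)
apply (cc_expansion_cv _ _ 8); [|lia|].
- intros M HM. apply zst_repeat2_app_expansion; [|easy].
  intros N _. apply (zst_cons1_expansion (repeat 2%nat n) (alt2 n)).
  apply zst_repeat2_expansion.
- intros k. unfold d. destruct k as [|k].
  { simpl INR. rewrite Rinv_0, Rmult_0_l, Rabs_R0. lra. }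
  rewrite Rabs_mult. pose proof (inv_INR_bounds (S k) ltac:(lia)).
  rewrite (Rabs_pos_eq (/ _)) by lra.
  pose proof (Rabs_triang (psum (alt2 n) (S k)) (psum (alt2 n) (pred (S k)))).
  pose proof (Rabs_psum_alt2 n (S k)). pose proof (Rabs_psum_alt2 n (pred (S k))).
  pose proof (Rabs_pos (psum (alt2 n) (S k) + psum (alt2 n) (pred (S k)))). nra.
Qed.

(** * Two-sided alternating sums *)

(* The sum of [(-1)^j / j^d] over the nonzero integers [j], in symmetric order; the value at
   [d = 0] is the convention for which [closed_form] below is uniform. *)
Definition sigma (d : nat) : R :=
  if Nat.even d then - zeta_star (repeat 2%nat (Nat.div2 d)) else 0.

Lemma sigma_even i : sigma (2 * i) = - zeta_star (repeat 2%nat i).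
Proof. unfold sigma. rewrite Nat.even_mul, Nat.div2_double. reflexivity. Qed.

Lemma sigma_odd i : sigma (2 * i + 1) = 0.
Proof. unfold sigma. rewrite Nat.even_odd. reflexivity. Qed.

Lemma sigma_0 : sigma 0 = -1.
Proof. unfold sigma. simpl. rewrite zeta_star_nil. ring. Qed.

(** Pairing [j] with [-j] gives the factor [1 + (-1)^d]: odd [d] cancels, even [d] gives
    [- alt2]. *)
Lemma sigma_cv d :
  (1 <= d)%nat ->
  is_lim_seq (psum (fun j => (-1) ^ j * (1 + (-1) ^ d) * ipow j d)) (sigma d).
Proof.
intros Hd. destruct (Nat.Even_or_Odd d) as [[i ->]|[i ->]].
- rewrite sigma_even.
  apply is_lim_seq_ext with (fun M => - psum (alt2 i) M).
  + intros M. replace (- psum (alt2 i) M) with ((-1) * psum (alt2 i) M) by ring.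
    rewrite <- psum_scal. apply psum_ext. intros k _.
    rewrite pow_m1_double. unfold alt2. ring.
  + apply (is_lim_seq_opp _ (zeta_star (repeat 2%nat i))).
    apply zeta_star_repeat2_cv. lia.
- rewrite sigma_odd. apply is_lim_seq_ext with (fun _ => 0); [|apply is_lim_seq_const].
  intros M. symmetry. apply psum_eq0. intros k _.
  rewrite pow_add, pow_m1_double. ring.
Qed.

(** * Shifted binomials and the partial fraction recursion *)

(* [C(c-1, a-1)], extended to [c = 0] and [a = 0] so that Pascal's rule always holds. *)
Definition bshift (c a : nat) : R :=
  match c, a with
  | O, O => 1
  | S c', S a' => INR (binom c' a')
  | _, _ => 0
  end.

Lemma binom_0_r c : binom c 0 = 1%nat.
Proof. now destruct c. Qed.

Lemma bshift_SS c a : bshift (S c) (S a) = bshift c a + bshift c (S a).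
Proof.
destruct c as [|c], a as [|a]; simpl; try ring.
- rewrite binom_0_r. simpl. ring.
- apply plus_INR.
Qed.

Lemma binom_lt c a : (c < a)%nat -> binom c a = 0%nat.
Proof.
revert a; induction c as [|c IH]; intros [|a] H; try lia; [easy|].
simpl. now rewrite !IH by lia.
Qed.

Lemma binom_diag c : binom c c = 1%nat.
Proof. induction c as [|c IH]; [easy|]. simpl. now rewrite IH, binom_lt by lia. Qed.

Lemma bshift_lt c a : (c < a)%nat -> bshift c a = 0.
Proof.
destruct c as [|c], a as [|a]; intros H; try lia; simpl; [easy|].
now rewrite binom_lt by lia.
Qed.

Lemma bshift_diag a : bshift a a = 1.
Proof. destruct a as [|a]; [easy|]. simpl. now rewrite binom_diag. Qed.

(* The contributions of [j] and [-j] to S_N(a,b). *)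
Definition two_sided (N a b j : nat) : R :=
  (-1) ^ j * ((/ (INR j + INR N)) ^ a * (/ INR j) ^ b +
    if Nat.eqb j N then 0 else (/ (INR N - INR j)) ^ a * (/ - INR j) ^ b).

(** For [a, b >= 1], expand [1/((j+N)^a j^b)] in partial fractions: the pole 0 gives the first
    summand, the pole [-N] the second, with [(-1)^N] from shifting [j]. The term [c = a + b], where
    [sigma 0 = -1], collects the corrections for the omitted indices 0 and [-N]. *)
Definition closed_term (N a b c : nat) : R :=
  (/ INR N) ^ c * sigma (a + b - c) *
  ((-1) ^ (c + a) * bshift c a + (-1) ^ (b + N) * bshift c b).

(** The term [c = 0] lies outside [psum]; it vanishes unless [a] or [b] is 0. *)
Definition closed_form (N a b : nat) : R :=
  closed_term N a b 0 + psum (closed_term N a b) (a + b).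

(** Both [N = (j+N) - j] and [N = (N-j) - (-j)] are used; for [j = N] the second part is omitted on
    both sides. *)
Lemma two_sided_rec N a b j :
  (1 <= N)%nat -> (1 <= j)%nat ->
  two_sided N (S a) (S b) j = / INR N * (two_sided N a (S b) j - two_sided N (S a) b j).
Proof.
intros HN Hj. pose proof (INR_ge1_pos N HN). pose proof (INR_ge1_pos j Hj).
unfold two_sided. simpl pow.
destruct (Nat.eqb_spec j N) as [E|E].
- field. split; lra.
- assert (INR N - INR j <> 0).
  { intros E'. apply E, INR_eq. lra. }
  field. repeat split; lra.
Qed.

(** Pascal's rule for both binomials; the factor [1/N] shifts [c] by one, so the terms [c = 0] on
    the right become [c = 1] on the left. *)
Lemma closed_form_rec N a b :
  (1 <= N)%nat ->
  closed_form N (S a) (S b) = / INR N * (closed_form N a (S b) - closed_form N (S a) b).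
Proof.
intros HN. unfold closed_form.
replace (S a + S b)%nat with (S (S (a + b))) by lia.
replace (a + S b)%nat with (S (a + b)) by lia.
replace (S a + b)%nat with (S (a + b)) by lia.
rewrite psum_shift.
assert (E : forall c, closed_term N (S a) (S b) (S c) =
  / INR N * closed_term N a (S b) c + / INR N * (-1) * closed_term N (S a) b c).
{ intros c. unfold closed_term. rewrite !bshift_SS.
  replace (S a + S b - S c)%nat with (S (a + b) - c)%nat by lia.
  replace (a + S b - c)%nat with (S (a + b) - c)%nat by lia.
  replace (S a + b - c)%nat with (S (a + b) - c)%nat by lia.
  replace (S c + S a)%nat with (S (S (c + a))) by lia.
  replace (c + S a)%nat with (S (c + a)) by lia.
  replace (S b + N)%nat with (S (b + N)) by lia.
  simpl pow. ring. }
rewrite E, (psum_ext _ _ _ (fun c _ => E c)), psum_plus, !psum_scal.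
replace (closed_term N (S a) (S b) 0) with 0; [ring|].
unfold closed_term. simpl bshift. ring.
Qed.

Lemma closed_form_ends N a b :
  (a = 0 \/ b = 0)%nat -> (1 <= a + b)%nat ->
  closed_form N a b = closed_term N a b 0 + closed_term N a b (a + b).
Proof.
intros H0 Hab. unfold closed_form. f_equal.
apply psum_single; [lia|]. intros k Hk Hne. unfold closed_term.
replace ((-1) ^ (k + a) * bshift k a + (-1) ^ (b + N) * bshift k b) with 0; [ring|].
destruct k as [|k]; [lia|].
destruct H0 as [-> | ->].
- rewrite (bshift_lt (S k) b) by lia. simpl bshift. ring.
- rewrite (bshift_lt (S k) a) by lia. simpl bshift. ring.
Qed.

(** * Evaluation of the two-sided sums *)

Lemma two_sided_0_cv N b :
  (1 <= N)%nat -> (1 <= b)%nat ->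
  is_lim_seq (psum (two_sided N 0 b)) (closed_form N 0 b).
Proof.
intros HN Hb.
rewrite closed_form_ends by lia. unfold closed_term. rewrite !Nat.add_0_l.
rewrite Nat.sub_0_r, Nat.sub_diag, sigma_0, !bshift_diag, (bshift_lt 0 b) by lia.
replace (bshift b 0) with 0 by (destruct b; [lia|easy]). simpl bshift.
(* [q] is the term of index [-N], which [two_sided] omits from the full sum [sigma b]. *)
set (q := (-1) ^ N * (/ - INR N) ^ b).
apply (is_lim_seq_ext_loc (fun M => psum (fun j => (-1) ^ j * (1 + (-1) ^ b) * ipow j b) M - q)).
- exists N. intros M HM.
  transitivity (psum (fun j => (-1) ^ j * (1 + (-1) ^ b) * ipow j b) M +
     psum (fun j => if Nat.eqb j N then - q else 0) M).
  + rewrite (psum_single (fun j => if Nat.eqb j N then - q else 0) N).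
    * rewrite Nat.eqb_refl. ring.
    * lia.
    * intros k _ Hk. destruct (Nat.eqb_spec k N); easy.
  + rewrite <- psum_plus. apply psum_ext. intros k _. unfold two_sided, ipow, q.
    assert (I : forall x, (/ - x) ^ b = (-1) ^ b * (/ x) ^ b).
    { intros x. rewrite <- Rpow_mult_distr. f_equal. rewrite Rinv_opp. ring. }
    rewrite !I. simpl (_ ^ 0).
    destruct (Nat.eqb_spec k N) as [->|Hk]; ring.
- replace (Finite _) with (Finite (sigma b - q)); [|f_equal; unfold q].
  + apply is_lim_seq_minus'; [now apply sigma_cv|apply is_lim_seq_const].
  + rewrite Rinv_opp.
    replace (- / INR N) with (-1 * / INR N) by ring.
    rewrite Rpow_mult_distr, !pow_add. simpl pow. ring.
Qed.

Lemma ipow_real_cv_0 a (u : nat -> R) :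
  (1 <= a)%nat -> is_lim_seq u p_infty -> is_lim_seq (fun n => (/ u n) ^ a) 0.
Proof.
intros Ha Hu.
assert (H1 : is_lim_seq (fun n => / u n) 0).
{ apply (is_lim_seq_inv _ p_infty); [exact Hu|easy]. }
destruct a as [|a]; [lia|]. clear Ha. induction a as [|a IH].
- apply is_lim_seq_ext with (2 := H1). intros; simpl; ring.
- replace (Finite 0) with (Finite (0 * 0)) by (f_equal; ring).
  exact (is_lim_seq_mult' (fun n => / u n) _ 0 0 H1 IH).
Qed.

Lemma is_lim_seq_mult_sign (u : nat -> R) :
  is_lim_seq u 0 -> is_lim_seq (fun n => (-1) ^ n * u n) 0.
Proof.
intros H. apply is_lim_seq_abs_0.
apply is_lim_seq_ext with (fun n => Rabs (u n)).
- intros n. now rewrite Rabs_mult, pow_1_abs, Rmult_1_l.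
- exact (proj1 (is_lim_seq_abs_0 u) H).
Qed.

(** For [a = 1] convergence is only conditional, so the shift of [j] by [N] is done one unit at a
    time on symmetric partial sums. The index [-N] contributes [/ 0 = 0]. *)
Lemma psum_sym_inv_cv a N :
  (1 <= a)%nat ->
  is_lim_seq
    (psum (fun j => (-1) ^ j * ((/ (INR j + INR N)) ^ a + (/ (INR N - INR j)) ^ a)))
    ((-1) ^ N * sigma a - (/ INR N) ^ a).
Proof.
intros Ha. induction N as [|N IH].
- simpl INR. rewrite Rinv_0, pow_i by lia.
  replace (Finite _) with (Finite (sigma a)) by (f_equal; simpl; ring).
  apply is_lim_seq_ext with (2 := sigma_cv a Ha).
  intros M. apply psum_ext. intros j _. unfold ipow.
  rewrite Rplus_0_r. replace (0 - INR j) with (- INR j) by ring.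
  rewrite Rinv_opp. replace (- / INR j) with (-1 * / INR j) by ring.
  rewrite Rpow_mult_distr. ring.
- set (v := fun N j => (-1) ^ j * ((/ (INR j + INR N)) ^ a + (/ (INR N - INR j)) ^ a)) in *.
  (* Shifting [j] by one flips the sign, exchanges two terms at the ends, which tend to 0, and swaps
     the omitted index 0 for 1, which gives the constants. *)
  assert (E : forall J, psum (v (S N)) J = - (psum (v N) J
     + (-1) ^ J * (- (/ (INR J + INR (S N))) ^ a)
     - (-1) ^ J * (/ (INR N - INR J)) ^ a
     + ((/ INR (S N)) ^ a + (/ INR N) ^ a))).
  { induction J as [|J IHJ].
    - rewrite !psum_0. change (INR 0) with 0. rewrite !Rplus_0_l, Rminus_0_r, pow_O. ring.
    - rewrite !psum_S, IHJ. unfold v. rewrite !(S_INR J), !(S_INR N).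
      replace (INR J + 1 + (INR N + 1)) with (INR J + (INR N + 1) + 1) by ring.
      replace (INR J + 1 + INR N) with (INR J + (INR N + 1)) by ring.
      replace (INR N + 1 - (INR J + 1)) with (INR N - INR J) by ring.
      simpl (_ ^ S J). ring. }
  apply is_lim_seq_ext with (1 := fun J => eq_sym (E J)).
  replace (Finite _) with (Finite (- ((-1) ^ N * sigma a - (/ INR N) ^ a + 0 - 0 +
    ((/ INR (S N)) ^ a + (/ INR N) ^ a)))) by (f_equal; simpl pow; ring).
  assert (L : forall c, is_lim_seq (fun J => INR J + c) p_infty).
  { intros c. eapply is_lim_seq_plus; [apply is_lim_seq_INR|apply is_lim_seq_const|reflexivity]. }
  refine (proj1 (is_lim_seq_opp _ (Finite _)) _). apply is_lim_seq_plus'; [|apply is_lim_seq_const].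
  apply is_lim_seq_minus'; [apply is_lim_seq_plus'; [exact IH|]|].
  + apply is_lim_seq_mult_sign.
    replace (Finite 0) with (Rbar_opp 0) by (simpl; f_equal; ring).
    refine (proj1 (is_lim_seq_opp _ 0) _). now apply ipow_real_cv_0.
  + apply is_lim_seq_mult_sign.
    apply is_lim_seq_ext with (fun J => (-1) ^ a * (/ (INR J + - INR N)) ^ a).
    { intros J. rewrite <- Rpow_mult_distr. f_equal.
      replace (INR N - INR J) with (- (INR J + - INR N)) by ring. rewrite Rinv_opp. ring. }
    replace (Finite 0) with (Finite ((-1) ^ a * 0)) by (f_equal; ring).
    apply is_lim_seq_mult'; [apply is_lim_seq_const|]. now apply ipow_real_cv_0.
Qed.

Lemma two_sided_r0_cv N a :
  (1 <= a)%nat ->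
  is_lim_seq (psum (two_sided N a 0)) (closed_form N a 0).
Proof.
intros Ha.
rewrite closed_form_ends by lia. rewrite Nat.add_0_r. unfold closed_term.
rewrite Nat.add_0_r, Nat.sub_0_r, Nat.sub_diag, sigma_0, !bshift_diag, (bshift_lt 0 a) by lia.
replace (bshift a 0) with 0 by (destruct a; [lia|easy]). simpl bshift.
replace (a + a)%nat with (2 * a)%nat by lia. rewrite pow_m1_double.
replace (Finite _) with (Finite ((-1) ^ N * sigma a - (/ INR N) ^ a))
  by (f_equal; simpl; ring).
apply is_lim_seq_ext with (2 := psum_sym_inv_cv a N Ha).
intros M. apply psum_ext. intros j _. unfold two_sided. simpl (_ ^ 0).
destruct (Nat.eqb_spec j N) as [->|Hj]; [|ring].
rewrite Rminus_diag, Rinv_0, pow_i by lia. ring.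
Qed.

(** Series and closed form obey the same recursion, which keeps [a + b] positive and ends at [a = 0]
    or [b = 0]. *)
Lemma two_sided_cv N a b :
  (1 <= N)%nat -> (1 <= a + b)%nat ->
  is_lim_seq (psum (two_sided N a b)) (closed_form N a b).
Proof.
intros HN. revert b. induction a as [|a IHa]; intros b Hab.
{ now apply two_sided_0_cv. }
induction b as [|b IHb]; [apply two_sided_r0_cv; lia|].
rewrite closed_form_rec by easy.
apply is_lim_seq_ext with
  (fun M => / INR N * (psum (two_sided N a (S b)) M - psum (two_sided N (S a) b) M)).
- intros M.
  transitivity (/ INR N * psum (fun j => two_sided N a (S b) j + (-1) * two_sided N (S a) b j) M).
  + rewrite psum_plus, psum_scal. ring.
  + rewrite <- psum_scal. apply psum_ext. intros j Hj.
    rewrite two_sided_rec by lia. ring.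
- apply is_lim_seq_mult'; [apply is_lim_seq_const|].
  apply is_lim_seq_minus'; [apply IHa; lia|apply IHb; lia].
Qed.

(** * Specialization to odd [a] and even [b], and alternating zeta values *)

Lemma psum_odd h n :
  psum h (2 * n + 1) = h 1%nat + psum (fun r => h (2 * r)%nat + h (2 * r + 1)%nat) n.
Proof.
induction n as [|n IH].
- rewrite psum_0. simpl. rewrite psum_S, psum_0. ring.
- replace (2 * S n + 1)%nat with (S (S (2 * n + 1))) by lia.
  rewrite 3!psum_S, IH.
  replace (2 * S n)%nat with (S (2 * n + 1)) by lia.
  replace (S (2 * n + 1) + 1)%nat with (S (S (2 * n + 1))) by lia. ring.
Qed.

(** As [a + b] is odd, [sigma (a + b - c)] vanishes for even [c]; the terms [c = 2r + 1] remain,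
    except [c = 1], where both binomials are 0 because [a, b >= 2]. *)
Lemma closed_form_odd_even N m n :
  (1 <= n)%nat ->
  closed_form N (2 * m + 3) (2 * n) =
  - psum (fun r => (INR (binom (2 * r) (2 * m + 2)) +
                    (-1) ^ N * INR (binom (2 * r) (2 * n - 1))) * ipow N (2 * r + 1) *
                   zeta_star (repeat 2%nat (m + n + 1 - r))) (m + n + 1).
Proof.
intros Hn. unfold closed_form.
replace (2 * m + 3)%nat with (S (2 * m + 2)) by lia.
replace (2 * n)%nat with (S (2 * n - 1)) at 1 2 3 by lia.
replace (S (2 * m + 2) + S (2 * n - 1))%nat with (2 * (m + n + 1) + 1)%nat by lia.
rewrite psum_odd.
replace (closed_term _ _ _ 0) with 0 by (unfold closed_term; simpl bshift; ring).
replace (closed_term _ _ _ 1) with 0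
  by (unfold closed_term; rewrite !bshift_lt by lia; ring).
rewrite !Rplus_0_l.
replace (- psum _ _) with ((-1) * psum (fun r => (INR (binom (2 * r) (2 * m + 2)) +
    (-1) ^ N * INR (binom (2 * r) (2 * n - 1))) * ipow N (2 * r + 1) *
    zeta_star (repeat 2%nat (m + n + 1 - r))) (m + n + 1)) by ring.
rewrite <- psum_scal. apply psum_ext. intros r Hr. unfold closed_term.
replace (S (2 * m + 2) + S (2 * n - 1) - 2 * r)%nat with (2 * (m + n + 1 - r) + 1)%nat by lia.
replace (S (2 * m + 2) + S (2 * n - 1) - (2 * r + 1))%nat with (2 * (m + n + 1 - r))%nat by lia.
rewrite sigma_odd, sigma_even.
replace (2 * r + 1 + S (2 * m + 2))%nat with (2 * (r + m + 2))%nat by lia.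
replace (S (2 * n - 1) + N)%nat with (2 * n + N)%nat by lia.
rewrite (pow_add (-1) (2 * n) N), !pow_m1_double.
replace (bshift (2 * r + 1)) with (bshift (S (2 * r))) by (f_equal; lia).
unfold bshift, ipow. ring.
Qed.

Lemma alternating_zeta_cv r :
  (1 <= r)%nat ->
  is_lim_seq (psum (fun k => (-1) ^ k * ipow k (2 * r + 1)))
    (- (1 - / 4 ^ r) * zeta (2 * r + 1)).
Proof.
intros Hr. set (s := (2 * r + 1)%nat).
assert (Hz : is_lim_seq (psum (fun k => ipow k s)) (zeta s)) by (apply zeta_cv; unfold s; lia).
destruct (psum_dominated_cv (fun k => (-1) ^ k * ipow k s) (fun k => ipow k s) (zeta s))
  as [l Hl]; [|exact Hz|].
{ intros k Hk. rewrite Rabs_mult, pow_1_abs, Rabs_pos_eq; [lra|]. now apply ipow_bounds. }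
assert (Hsub : filterlim (fun M => (2 * M)%nat) eventually eventually).
{ apply eventually_subseq. intros; lia. }
(* The even [k] are counted twice and all [k] subtracted once; with [s = 2r + 1], [2 * 2^-s = 4^-r].
   Since the whole sequence converges, its even subsequence determines the limit. *)
assert (E : forall M, psum (fun k => (-1) ^ k * ipow k s) (2 * M) =
  / 4 ^ r * psum (fun k => ipow k s) M - psum (fun k => ipow k s) (2 * M)).
{ induction M as [|M IH]; [rewrite !psum_0; ring|].
  replace (2 * S M)%nat with (S (S (2 * M))) by lia.
  rewrite !psum_S, IH.
  assert (I : ipow (S (S (2 * M))) s = / 2 * / 4 ^ r * ipow (S M) s).
  { unfold ipow. replace (S (S (2 * M))) with (2 * S M)%nat by lia.
    rewrite mult_INR, Rinv_mult, Rpow_mult_distr. f_equal. unfold s.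
    rewrite pow_add, pow_mult. simpl INR. rewrite <- pow_inv.
    replace ((/ (1 + 1)) ^ 2) with (/ 4) by field.
    simpl (_ ^ 1). field. }
  rewrite I. change ((-1) ^ S (S (2 * M))) with (-1 * (-1 * (-1) ^ (2 * M))).
  change ((-1) ^ S (2 * M)) with (-1 * (-1) ^ (2 * M)).
  rewrite pow_m1_double. field. apply pow_nonzero; lra. }
replace (- (1 - / 4 ^ r) * zeta s) with l; [exact Hl|].
assert (H1 := is_lim_seq_subseq _ _ _ Hsub Hl).
assert (H2 : is_lim_seq (fun M => psum (fun k => (-1) ^ k * ipow k s) (2 * M))
               (/ 4 ^ r * zeta s - zeta s)).
{ apply is_lim_seq_ext with (1 := fun M => eq_sym (E M)).
  apply is_lim_seq_minus'.
  - apply is_lim_seq_mult'; [apply is_lim_seq_const|exact Hz].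
  - exact (is_lim_seq_subseq _ _ _ Hsub Hz). }
rewrite (is_lim_seq_eq _ _ _ H1 H2). ring.
Qed.

(** * Exchanging the sums over [N] and [j] *)

(* Since the exponent is odd, [N = j - i] and [N = j + i] cancel; [N = j] contributes [/ 0 = 0]. *)
Lemma psum_shifted_odd_cv m j (P := psum (fun k => ipow k (2 * m + 3))) :
  is_lim_seq (psum (fun N => (/ (INR N - INR j)) ^ (2 * m + 3)))
    (zeta (2 * m + 3) - P (pred j)).
Proof.
induction j as [|j IH].
- simpl pred. unfold P. rewrite psum_0, Rminus_0_r.
  apply is_lim_seq_ext with (2 := zeta_cv (2 * m + 3) ltac:(lia)).
  intros M. apply psum_ext. intros k _. unfold ipow. simpl INR. now rewrite Rminus_0_r.
- apply is_lim_seq_incr_1.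
  apply is_lim_seq_ext with
    (fun M => - ipow j (2 * m + 3) + psum (fun N => (/ (INR N - INR j)) ^ (2 * m + 3)) M).
  + intros M. rewrite psum_shift. f_equal.
    * rewrite (S_INR j). change (INR 1) with 1. replace (1 - (INR j + 1)) with (- INR j) by ring.
      rewrite Rinv_opp. replace (- / INR j) with (-1 * / INR j) by ring.
      rewrite Rpow_mult_distr. rewrite (pow_add (-1)), pow_m1_double. unfold ipow. ring.
    * apply psum_ext. intros k _. rewrite !S_INR. do 2 f_equal. ring.
  + replace (Finite (zeta (2 * m + 3) - P (pred (S j)))) with
      (Finite (- ipow j (2 * m + 3) + (zeta (2 * m + 3) - P (pred j)))).
    * apply is_lim_seq_plus'; [apply is_lim_seq_const|exact IH].
    * f_equal. simpl pred. destruct j as [|j].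
      (* Passing from [j = 0] to [j = 1] changes nothing, as [/ 0 = 0] and [pred 0 = 0]. *)
      { unfold ipow. simpl INR. rewrite Rinv_0, pow_i by lia. simpl pred. ring. }
      simpl pred. unfold P. rewrite psum_S. ring.
Qed.

(** The [N > j] contribute at most [P M], the [N < j] at most [P (j-1)]. As [P <= 2], this is
    uniform in [M] and [j], as domination requires. *)
Lemma Rabs_psum_shifted_odd m j M (P := psum (fun k => ipow k (2 * m + 3))) :
  Rabs (psum (fun N => (/ (INR N - INR j)) ^ (2 * m + 3)) M) <= P M + P (pred j).
Proof.
revert M; induction j as [|j IH]; intros M.
- simpl pred. unfold P. rewrite psum_0, Rplus_0_r.
  apply Rabs_psum. intros k Hk. simpl INR. rewrite Rminus_0_r.
  rewrite Rabs_pos_eq; [apply Rle_refl|]. now apply ipow_bounds.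
- destruct M as [|M].
  { rewrite psum_0, Rabs_R0. unfold P.
    pose proof (psum_ipow_le (2 * m + 3) 0 ltac:(lia)).
    pose proof (psum_ipow_le (2 * m + 3) (pred (S j)) ltac:(lia)). lra. }
  rewrite psum_shift.
  rewrite (psum_ext (fun k => (/ (INR (S k) - INR (S j))) ^ (2 * m + 3))
     (fun k => (/ (INR k - INR j)) ^ (2 * m + 3)))
    by (intros k _; rewrite !S_INR; do 2 f_equal; ring).
  eapply Rle_trans; [apply Rabs_triang|].
  specialize (IH M).
  assert (E : Rabs ((/ (INR 1 - INR (S j))) ^ (2 * m + 3)) + P (pred j) = P j).
  { rewrite (S_INR j). change (INR 1) with 1. replace (1 - (INR j + 1)) with (- INR j) by ring.
    destruct j as [|j].
    - simpl INR. rewrite Ropp_0, Rinv_0, pow_i by lia. rewrite Rabs_R0. simpl pred. ring.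
    - simpl pred. unfold P. rewrite psum_S, <- RPow_abs, Rinv_opp, Rabs_Ropp.
      rewrite Rabs_pos_eq; [unfold ipow; ring|].
      apply Rlt_le, inv_INR_bounds; lia. }
  assert (P M <= P (S M)).
  { unfold P. rewrite psum_S. pose proof (ipow_bounds (S M) (2 * m + 3) ltac:(lia)). lra. }
  simpl pred. lra.
Qed.

(** Collecting by [j]: the coefficient [alt2 n j] enters the first inner sum for [k >= j] and the
    second for [k > j]. *)
Lemma psum_alt2_abel m n K (P := psum (fun k => ipow k (2 * m + 3))) :
  psum (fun k => ipow k (2 * m + 3) * (psum (alt2 n) k + psum (alt2 n) (pred k))) K =
  psum (fun j => alt2 n j * (2 * P K - P j - P (pred j))) K.
Proof.
induction K as [|K IH]; [now rewrite !psum_0|].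
rewrite !psum_S, IH. simpl pred.
transitivity (psum (fun j => alt2 n j * (2 * P K - P j - P (pred j)) +
    2 * ipow (S K) (2 * m + 3) * alt2 n j) K + alt2 n (S K) * ipow (S K) (2 * m + 3)).
- rewrite psum_plus, psum_scal. ring.
- replace (P (S K)) with (P K + ipow (S K) (2 * m + 3)) by (unfold P; now rewrite psum_S).
  f_equal; [|ring]. apply psum_ext. intros j _. ring.
Qed.

(** As [b] is even, [j] and [-j] share the factor [(-1)^j j^-b], which is [-1/2] times [alt2 n j];
    the omitted case [N = j] agrees with [/ 0 = 0]. *)
Lemma psum_two_sided m n M j (P := psum (fun k => ipow k (2 * m + 3))) :
  (1 <= j)%nat ->
  psum (fun N => two_sided N (2 * m + 3) (2 * n) j) M =
  - / 2 * alt2 n j *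
    (P (M + j)%nat - P j + psum (fun N => (/ (INR N - INR j)) ^ (2 * m + 3)) M).
Proof.
intros Hj. induction M as [|M IH].
{ rewrite !psum_0. simpl Nat.add. ring. }
rewrite !psum_S, IH.
replace (P (S M + j)%nat) with (P (M + j)%nat + ipow (M + 1 + j) (2 * m + 3))
  by (unfold P; replace (S M + j)%nat with (S (M + j)) by lia; rewrite psum_S;
      do 2 f_equal; lia).
unfold two_sided, alt2.
assert (E : (/ - INR j) ^ (2 * n) = ipow j (2 * n)).
{ unfold ipow. rewrite !pow_mult, Rinv_opp. f_equal. ring. }
rewrite E. unfold ipow at 4. replace (M + 1 + j)%nat with (j + S M)%nat by lia.
rewrite plus_INR.
destruct (Nat.eqb_spec j (S M)) as [<-|Hne].
- rewrite Rminus_diag, Rinv_0, (pow_i (2 * m + 3)) by lia. unfold ipow. field.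
- unfold ipow. field.
Qed.

(** Both limits are computed from the single series of [g]: for fixed [j], the sum over [N] gives
    [(z - P j) + (z - P (j-1))], half of it negated against [alt2 n j]. *)
Lemma zeta_star_212_interchange m n :
  (1 <= n)%nat -> exists l : R,
  is_lim_seq (psum (fun k =>
    ipow k (2 * m + 3) * (psum (alt2 n) k + psum (alt2 n) (pred k)))) l /\
  is_lim_seq (psum (fun N => closed_form N (2 * m + 3) (2 * n))) (- / 2 * l).
Proof.
intros Hn. set (P := psum (fun k => ipow k (2 * m + 3))).
assert (HP : forall k, 0 <= P k <= 2) by (intros; apply psum_ipow_le; lia).
assert (HPz : is_lim_seq P (zeta (2 * m + 3))) by (apply zeta_cv; lia).
set (z := zeta (2 * m + 3)) in *.
assert (Hz : 0 <= z <= 2).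
{ split.
  - exact (is_lim_seq_le _ _ 0 z (fun k => proj1 (HP k)) (is_lim_seq_const 0) HPz).
  - exact (is_lim_seq_le _ _ z 2 (fun k => proj2 (HP k)) HPz (is_lim_seq_const 2)). }
destruct (psum_ipow_cv (2 * n) ltac:(lia)) as [s Hs].
(* 16 is 2 from [Rabs_alt2] times 8, a bound for every cofactor below since [P] and [z] lie in
   [[0,2]]. *)
set (B := fun k => 16 * ipow k (2 * n)).
assert (HB : is_lim_seq (psum B) (16 * s)).
{ apply is_lim_seq_ext with (fun M => 16 * psum (fun k => ipow k (2 * n)) M).
  - intros; unfold B; now rewrite psum_scal.
  - apply is_lim_seq_mult'; [apply is_lim_seq_const|exact Hs]. }
assert (Hbd : forall k x, (1 <= k)%nat -> -8 <= x <= 8 -> Rabs (alt2 n k * x) <= B k).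
{ intros k x Hk Hx. rewrite Rabs_mult, Rabs_alt2 by easy. unfold B.
  pose proof (ipow_bounds k (2 * n) Hk). apply Rabs_le in Hx. nra. }
set (g := fun j => alt2 n j * (2 * z - P j - P (pred j))).
destruct (psum_dominated_cv g B (16 * s)) as [l Hl]; [|exact HB|].
{ intros k Hk. apply Hbd; [easy|]. pose proof (HP k). pose proof (HP (pred k)). lra. }
exists l. split.
- apply is_lim_seq_ext with (1 := fun K => eq_sym (psum_alt2_abel m n K)).
  apply (tannery_diag (fun M j => alt2 n j * (2 * P M - P j - P (pred j))) g B (16 * s)); auto.
  + intros M k Hk. apply Hbd; [easy|].
    pose proof (HP k). pose proof (HP (pred k)). pose proof (HP M). lra.
  + intros k Hk. apply is_lim_seq_mult'; [apply is_lim_seq_const|].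
    apply is_lim_seq_minus'; [|apply is_lim_seq_const].
    apply is_lim_seq_minus'; [|apply is_lim_seq_const].
    apply is_lim_seq_mult'; [apply is_lim_seq_const|exact HPz].
- apply (tannery_series
    (fun M j => psum (fun N => two_sided N (2 * m + 3) (2 * n) j) M) _
    (fun j => - / 2 * g j) B (16 * s)); auto.
  + intros M k Hk. rewrite psum_two_sided by easy. fold P.
    set (G := psum (fun N => (/ (INR N - INR k)) ^ (2 * m + 3)) M).
    replace (- / 2 * alt2 n k * (P (M + k)%nat - P k + G))
      with (alt2 n k * (- / 2 * (P (M + k)%nat - P k + G))) by ring.
    apply Hbd; [easy|].
    assert (HG : Rabs G <= P M + P (pred k)) by apply Rabs_psum_shifted_odd.
    apply Rabs_le_between in HG.
    pose proof (HP k). pose proof (HP (pred k)). pose proof (HP M).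
    pose proof (HP (M + k)%nat). lra.
  + intros M.
    (* Only finitely many [N] occur here, so they may be summed after the series in [j]. *)
    apply is_lim_seq_ext with
      (fun J => psum (fun N => psum (two_sided N (2 * m + 3) (2 * n)) J) M).
    { intros J. apply psum_swap. }
    apply (is_lim_seq_psum (fun J N => psum (two_sided N (2 * m + 3) (2 * n)) J)).
    intros N HN. apply two_sided_cv; lia.
  + intros k Hk.
    apply is_lim_seq_ext with (fun M => - / 2 * alt2 n k *
      (P (M + k)%nat - P k + psum (fun N => (/ (INR N - INR k)) ^ (2 * m + 3)) M)).
    { intros M. now rewrite psum_two_sided. }
    replace (Finite (- / 2 * g k)) with
      (Finite (- / 2 * alt2 n k * (z - P k + (z - P (pred k)))))
      by (f_equal; unfold g; ring).
    apply is_lim_seq_mult'; [apply is_lim_seq_const|].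
    apply is_lim_seq_plus'; [|apply psum_shifted_odd_cv].
    apply is_lim_seq_minus'; [|apply is_lim_seq_const].
    now apply -> is_lim_seq_incr_n.
  + apply is_lim_seq_ext with (fun M => - / 2 * psum g M).
    { intros M. now rewrite psum_scal. }
    apply is_lim_seq_mult'; [apply is_lim_seq_const|exact Hl].
Qed.

(** * Summation over [N] and conclusion *)

Lemma psum_closed_form_cv m n :
  (1 <= n)%nat ->
  is_lim_seq (psum (fun N => closed_form N (2 * m + 3) (2 * n)))
    (- psum (fun r => (INR (binom (2 * r) (2 * m + 2)) -
         (1 - / 4 ^ r) * INR (binom (2 * r) (2 * n - 1))) * zeta (2 * r + 1) *
         zeta_star (repeat 2%nat (m + n + 1 - r))) (m + n + 1)).
Proof.
intros Hn.
set (Z := fun r => zeta_star (repeat 2%nat (m + n + 1 - r))).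
set (b1 := fun r => INR (binom (2 * r) (2 * m + 2))).
set (b2 := fun r => INR (binom (2 * r) (2 * n - 1))).
apply is_lim_seq_ext with (fun M => - psum (fun r =>
   Z r * (b1 r * psum (fun N => ipow N (2 * r + 1)) M +
          b2 r * psum (fun N => (-1) ^ N * ipow N (2 * r + 1)) M)) (m + n + 1)).
- intros M.
  replace (psum (fun N => closed_form N (2 * m + 3) (2 * n)) M) with
    ((-1) * psum (fun N => psum (fun r => (b1 r + (-1) ^ N * b2 r) * ipow N (2 * r + 1) * Z r)
                   (m + n + 1)) M).
  + rewrite psum_swap.
    transitivity ((-1) * psum (fun r =>
      Z r * (b1 r * psum (fun N => ipow N (2 * r + 1)) M +
          b2 r * psum (fun N => (-1) ^ N * ipow N (2 * r + 1)) M)) (m + n + 1)); [ring|].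
    f_equal. apply psum_ext. intros r _.
    rewrite <- !psum_scal, <- psum_plus, <- psum_scal.
    apply psum_ext. intros N _. ring.
  + rewrite <- psum_scal. apply psum_ext. intros N _.
    rewrite closed_form_odd_even by easy. unfold b1, b2, Z. ring.
- refine (proj1 (is_lim_seq_opp _ (Finite _)) _).
  apply (is_lim_seq_psum (fun M r => Z r * (b1 r * psum (fun N => ipow N (2 * r + 1)) M +
          b2 r * psum (fun N => (-1) ^ N * ipow N (2 * r + 1)) M))).
  intros r Hr.
  replace (Finite _) with (Finite (Z r * (b1 r * zeta (2 * r + 1) +
    b2 r * (- (1 - / 4 ^ r) * zeta (2 * r + 1)))))
    by (f_equal; unfold b1, b2, Z; ring).
  apply is_lim_seq_mult'; [apply is_lim_seq_const|].
  apply is_lim_seq_plus'.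
  + apply is_lim_seq_mult'; [apply is_lim_seq_const|]. apply zeta_cv; lia.
  + apply is_lim_seq_mult'; [apply is_lim_seq_const|]. apply alternating_zeta_cv; lia.
Qed.

(** For [n = 0] two consecutive partial sums of [alt2 0] always add up to 2. *)
Lemma zeta_star_21 m :
  zeta_star (repeat 2%nat (m + 1) ++ 1%nat :: nil) = 2 * zeta (2 * m + 3).
Proof.
apply (is_lim_seq_eq _ _ _ (zeta_star_212_cv m 0)).
apply is_lim_seq_ext with (fun M => 2 * psum (fun k => ipow k (2 * m + 3)) M).
- intros M. rewrite <- psum_scal. apply psum_ext. intros k Hk.
  destruct k as [|k]; [lia|]. simpl pred. rewrite psum_S.
  rewrite psum_alt2_0. unfold alt2. simpl (2 * 0)%nat. unfold ipow. simpl pow. ring.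
- apply is_lim_seq_mult'; [apply is_lim_seq_const|]. apply zeta_cv; lia.
Qed.

Theorem theorem1p6 (m n : nat) :
  zeta_star (repeat 2%nat (m + 1) ++ 1%nat :: repeat 2%nat n) =
  2 * sum_n_m (fun r =>
        (binomZ (2 * r) (Z.of_nat (2 * m + 2))
         - (1 - / 4 ^ r) * binomZ (2 * r) (2 * Z.of_nat n - 1)%Z)
        * zeta (2 * r + 1) * zeta_star (repeat 2%nat (m + n + 1 - r)))
      1 (m + n + 1).
Proof.
change (sum_n_m ?f 1 ?k) with (psum f k).
assert (E1 : forall r, binomZ (2 * r) (Z.of_nat (2 * m + 2)) = INR (binom (2 * r) (2 * m + 2))).
{ intros r. unfold binomZ. destruct (Z.ltb_spec (Z.of_nat (2 * m + 2)) 0); [lia|].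
  now rewrite Nat2Z.id. }
destruct (Nat.eq_dec n 0) as [->|Hn].
(* For [n = 0] the second binomial has lower index [-1], and the first needs [r >= m + 1], so only
   the last term survives. *)
- rewrite (psum_single _ (m + 1)).
  + rewrite E1. replace (2 * (m + 1))%nat with (2 * m + 2)%nat by lia.
    rewrite binom_diag. replace (m + 0 + 1 - (m + 1))%nat with 0%nat by lia.
    simpl repeat. rewrite zeta_star_nil, zeta_star_21.
    replace (2 * m + 2 + 1)%nat with (2 * m + 3)%nat by lia.
    unfold binomZ. simpl. ring.
  + lia.
  + intros r Hr Hne. rewrite E1, binom_lt by lia. unfold binomZ. simpl. ring.
(* The star value is [l], and the sum over [N] tends both to [-l/2] and to minus the sum over [r];
   this is the factor 2. *)
- destruct (zeta_star_212_interchange m n ltac:(lia)) as [l [H1 H2]].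
  pose proof (zeta_star_212_cv m n) as H3.
  pose proof (psum_closed_form_cv m n ltac:(lia)) as H4.
  rewrite (is_lim_seq_eq _ _ _ H3 H1).
  pose proof (is_lim_seq_eq _ _ _ H2 H4) as E.
  rewrite (psum_ext _ (fun r => (INR (binom (2 * r) (2 * m + 2)) -
         (1 - / 4 ^ r) * INR (binom (2 * r) (2 * n - 1))) * zeta (2 * r + 1) *
         zeta_star (repeat 2%nat (m + n + 1 - r)))).
  + lra.
  + intros r _. rewrite E1. do 4 f_equal. unfold binomZ.
    destruct (Z.ltb_spec (2 * Z.of_nat n - 1) 0); [lia|]. do 2 f_equal. lia.
Qed.
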